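(* Let $K\ge1$, and let $X$ be a Banach space (over $\mathbb K\in\{\mathbb R,\mathbb C\}$) with a $K$-unconditional basis. If $X$ has the super Alternative Daugavet property (super ADP), then for every $m\in\mathbb N$ and $0<\varepsilon<1/m$, there exist successive blocks $u_1,\dots,u_m\in S_X$ such that $$\left\|\sum_{j=1}^m u_j\right\|>(1-\varepsilon)m$$ and, for every $a_1,\dots,a_m\in\mathbb K$, $$\frac{1-m\varepsilon}{K}\sum_{j=1}^m|a_j|\le\left\|\sum_{j=1}^m a_ju_j\right\|\le\sum_{j=1}^m|a_j|.$$ In particular, for every $m\in\mathbb N$ and every $\eta>0$, there exist $m$ successive normalized blocks which are $K(1+\eta)$-equivalent to the canonical basis of $\ell_1^m$.
   Context: $\mathbb T$ denotes the set of scalars of modulus one. $B_X$, $S_X$ are the closed unit ball and unit sphere of $X$. Super ADP: for every $x\in S_X$ and every relatively weakly open $W\subset B_X$ with $W\cap S_X\ne\varnothing$, $\sup_{y\in W}\max_{\theta\in\mathbb T}\|x+\theta y\|=2$. $K$-unconditional basis: a Schauder basis $(e_j)_{j=1}^\infty$ such that for every $N$ and all scalars with $|a_j|\le|b_j|$ for $1\le j\le N$, $\left\|\sum_{j=1}^N a_je_j\right\|\le K\left\|\sum_{j=1}^N b_je_j\right\|$. Vectors $u_1,\dots,u_m$ are successive blocks (of the basis $(e_j)$) if there are finite sets $F_1,\dots,F_m\subset\mathbb N$ with $\max F_k<\min F_{k+1}$ and $u_k\in\operatorname{span}\{e_j:j\in F_k\}$; they are normalized if $\|u_k\|=1$ for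 all $k$. A finite sequence $(u_1,\dots,u_m)$ is $C$-equivalent to the canonical basis of $\ell_1^m$ ($C\ge 1$) if $\frac1C\sum_{j=1}^m|a_j|\le\left\|\sum_{j=1}^m a_ju_j\right\|\le C\sum_{j=1}^m|a_j|$ for all scalars $a_1,\dots,a_m$. *)

(* Defs.v *)
From HB Require Import structures.
From mathcomp Require Import all_boot all_order all_algebra.
From mathcomp Require Import finmap.
From mathcomp Require Import complex.
From mathcomp Require Import all_classical all_reals.
From mathcomp Require Import topology normedtype sequences.

Set Implicit Arguments.
Unset Strict Implicit.
Unset Printing Implicit Defensive.

Import Order.TTheory GRing.Theory Num.Theory.
Import numFieldNormedType.Exports.

Local Open Scope classical_set_scope.
Local Open Scope ring_scope.

(* MathComp-Analysis norms take their values in the scalar field F itself.  In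
   R[i], x <= y means that y - x is a nonnegative real; so every scalar that is
   compared with 0, 1 or a norm below is automatically real. *)

Variant scalars := RealScalars | ComplexScalars.

Definition scalar_field (R : realType) (k : scalars) : numFieldType :=
  match k with
  | RealScalars => R
  | ComplexScalars => R[i]
  end.

Section Definitions.
Variables (F : numFieldType) (X : completeNormedModType F).
Implicit Types (x y : X) (e : nat -> X) (C : F).

Definition unit_ball : set X := [set x | `|x| <= 1].
Definition unit_sphere : set X := [set x | `|x| = 1].
Definition unimodular : set F := [set theta | `|theta| = 1].

Definition dual := {f : {linear X -> F^o} | continuous f}.

Definition weak_topology : topologicalType :=
  sup_topology (fun f : dual =>
    Topological.on (initial_topology (sval f : X -> F^o))).

Definition relatively_weakly_open (B W : set X) :=
  exists2 U : set X, @open weak_topology U & W = B `&` U.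

Definition is_max (A : set F) (M : F) := A M /\ ubound A M.

Definition super_ADP :=
  forall x (W : set X), unit_sphere x ->
    relatively_weakly_open unit_ball W -> W `&` unit_sphere !=set0 ->
    isLub [set M | exists2 y, W y &
             is_max [set `|x + theta *: y| | theta in unimodular] M] 2.

Definition schauder_basis e :=
  forall x, exists! a : nat -> F,
    series (fun j => a j *: e j) n @[n --> \oo] --> x.

(* The basis is indexed from 0. *)
Definition unconditional_basis C e :=
  schauder_basis e /\
  forall (N : nat) (a b : nat -> F),
    (forall j, (j < N)%N -> `|a j| <= `|b j|) ->
    `|\sum_(j < N) a j *: e j| <= C * `|\sum_(j < N) b j *: e j|.

Definition in_span e (J : {fset nat}) x :=
  exists a : nat -> F, x = \sum_(j <- J) a j *: e j.

(* The third condition is max (J k) < min (J (k+1)), which makes sense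
   because the sets are nonempty. *)
Definition successive_blocks e (m : nat) (u : 'I_m -> X) :=
  exists J : 'I_m -> {fset nat},
    [/\ forall k, J k != fset0,
        forall k, in_span e (J k) (u k)
      & forall k l : 'I_m, l = k.+1 :> nat ->
          forall i j, i \in J k -> j \in J l -> (i < j)%N].

Definition normalized (m : nat) (u : 'I_m -> X) := forall k, unit_sphere (u k).

Definition equivalent_l1 C (m : nat) (u : 'I_m -> X) :=
  forall a : 'I_m -> F,
    C^-1 * \sum_(j < m) `|a j| <= `|\sum_(j < m) a j *: u j|
    /\ `|\sum_(j < m) a j *: u j| <= C * \sum_(j < m) `|a j|.

End Definitions.

Arguments super_ADP {F} X.

(* Main.v *)
(* Unconditionality bounds |c_j(x)| |e_j| by K |x|, so the coordinate functionals
   c_j are continuous and {y in B_X : |c_j(y)| < r_j for j < N} is weakly open in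
   B_X.  Applied to this set, the super ADP yields, for every vector s, a point y
   with negligible coordinates below N such that |s + theta y| is almost |s| + 1;
   truncating and normalizing theta y gives a block u beyond N with
   |s + u| > |s| + 1 - eps.  Iterating, |u_1 + ... + u_m| > (1 - eps) m, and the
   triangle inequality gives |sum |a_j| u_j| >= (1 - m eps) sum |a_j|; the
   moduli are removed by unconditionality at the cost of the factor K. *)
Require Import Defs.
From HB Require Import structures.
From mathcomp Require Import all_boot all_order all_algebra.
From mathcomp Require Import finmap.
From mathcomp Require Import complex ring.
From mathcomp Require Import all_classical all_reals.
From mathcomp Require Import topology normedtype sequences.


Set Implicit Arguments.
Unset Strict Implicit.
Unset Printing Implicit Defensive.

Import Order.TTheory GRing.Theory Num.Theory.
Import numFieldNormedType.Exports.

Local Open Scope classical_set_scope.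
Local Open Scope ring_scope.

(** * Coordinate functionals and weakly open sets *)

Section Coordinates.
Variables (F : numFieldType) (X : completeNormedModType F) (e : nat -> X).
Hypothesis basis_e : schauder_basis e.

Definition coord (x : X) : nat -> F := sval (cid (basis_e x)).

Lemma cvg_coord (x : X) : series (fun j => coord x j *: e j) n @[n --> \oo] --> x.
Proof. by rewrite /coord; case: cid => a []. Qed.

Lemma coord_unique (x : X) (a : nat -> F) :
  series (fun j => a j *: e j) n @[n --> \oo] --> x -> coord x = a.
Proof. by rewrite /coord; case: cid => b [/= _ ub] /ub. Qed.

(** [coord] with its arguments swapped and values in [F^o], the form in which a linear functional
    belongs to [dual]. *)
Definition coord_fun (j : nat) (x : X) : F^o := coord x j.

Lemma coord_is_linear j : linear (coord_fun j).
Proof.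
move=> c x y; rewrite /coord_fun.
rewrite (@coord_unique _ (fun i => c * coord x i + coord y i)) //.
have -> : series (fun i => (c * coord x i + coord y i) *: e i) =
          (c \*: series (fun i => coord x i *: e i)) +
          series (fun i => coord y i *: e i).
  apply/funext => n; rewrite /series /= !fctE /= scaler_sumr -big_split /=.
  by apply: eq_bigr => i _; rewrite scalerDl scalerA.
by apply: cvgD; [apply: cvgZl_tmp|]; exact: cvg_coord.
Qed.

HB.instance Definition _ j :=
  GRing.isLinear.Build F X F^o _ (coord_fun j) (coord_is_linear j).

Lemma coord_basis (i j : nat) : coord (e i) j = (j == i)%:R.
Proof.
rewrite (@coord_unique _ (fun j => (j == i)%:R)) //.
apply: cvg_near_cst; exists i.+1 => // n /= ltin.
rewrite /series /= big_mkord (bigD1 (Ordinal ltin)) //= eqxx scale1r.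
rewrite big1 ?addr0 // => l; rewrite -val_eqE /= => /negPf->.
by rewrite scale0r.
Qed.

(** Were [e i] zero, the zero expansion would represent it, yet its [i]-th coordinate is 1. *)
Lemma basis_neq0 (i : nat) : e i != 0.
Proof.
apply/eqP => ei0; have := coord_basis i i; rewrite eqxx ei0.
rewrite (@coord_unique _ (fun=> 0)).
  by move/eqP; rewrite eq_sym oner_eq0.
by apply: cvg_near_cst; near=> n; rewrite /series /= big1 // => l _; rewrite scale0r.
Unshelve. all: end_near.
Qed.

Lemma partial_sum_close (x : X) (d : F) (N : nat) : 0 < d ->
  exists2 n, (N <= n)%N & `|x - \sum_(0 <= j < n) coord x j *: e j| < d.
Proof.
move=> d0; have /cvgrPdist_lt/(_ d d0)[M _ hM] := @cvg_coord x.
by exists (maxn N M); [exact: leq_maxl | apply: hM; exact: leq_maxr].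
Qed.

Variable K : F.
Hypothesis K1 : 1 <= K.
Hypothesis uncond_e : unconditional_basis K e.

(** Unconditionality compares the single term [j] with a partial sum containing it; such partial
    sums approximate [x]. *)
Lemma coord_bound (j : nat) (x : X) : `|coord x j| * `|e j| <= K * `|x|.
Proof.
have K0 : 0 < K by rewrite (lt_le_trans ltr01).
apply/ler_addgt0Pr => d d0.
(* The error is later multiplied by [K], hence [d / K]; [n > j] keeps the term [j] in the sum. *)
have [n ltjn hn] := @partial_sum_close x (d / K) j.+1 (divr_gt0 d0 K0).
pose a i := if i == j then coord x j else 0.
have /(uncond_e.2 n) : forall i, (i < n)%N -> `|a i| <= `|coord x i|.
  by move=> i _; rewrite /a; case: eqP => [->//|_]; rewrite normr0.
rewrite (bigD1 (Ordinal ltjn)) //= {1}/a eqxx big1 ?addr0; last first.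
  by move=> i; rewrite -val_eqE /a /= => /negPf->; rewrite scale0r.
rewrite normrZ => /le_trans; apply.
rewrite big_mkord distrC in hn.
rewrite -[X in _ + X](mulfVK (lt0r_neq0 K0)) [X in _ + X]mulrC -mulrDr.
rewrite ler_pM2l // -lerBlDl (le_trans _ (ltW hn)) //.
by rewrite lerBlDl -{1}[X in `|X|](subrK x) addrC ler_normD.
Qed.

Lemma coord_fun_continuous j : continuous (coord_fun j).
Proof.
apply: bounded_linear_continuous; apply/linear_boundedP.
near=> r => x; have ej0 : 0 < `|e j| by rewrite normr_gt0 basis_neq0.
rewrite /coord_fun -(ler_pM2r ej0) (le_trans (coord_bound j x)) //.
rewrite mulrAC ler_wpM2r // -ler_pdivrMr //.
by near: r; apply: nbhs_pinfty_ge; rewrite ger0_real // divr_ge0 // (le_trans ler01).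
Unshelve. all: end_near.
Qed.

Lemma weak_open_coord (N : nat) (r : nat -> F) :
  @open (weak_topology X) [set y | forall j, (j < N)%N -> `|coord y j| < r j].
Proof.
have op j : @open (weak_topology X) [set y | `|coord y j| < r j].
  pose f : dual X := exist (fun f : {linear X -> F^o} => continuous f)
    (coord_fun j) (@coord_fun_continuous j).
  (* Open sets of the supremum topology are unions of finite intersections of preimages; here both
     families are singletons. *)
  exists [set [set y | `|coord y j| < r j]]; last by rewrite bigcup_set1.
  move=> _ ->; exists [fset [set y : X | `|coord y j| < r j]]%fset; last first.
    by rewrite set_fset1 bigcap_set1.
  move=> A /fset1P ->; rewrite inE; exists f => //.
  exists (ball (0 : F^o) (r j)); first exact: ball_open.
  by apply/seteqP; split=> y; rewrite /= -ball_normE /= sub0r normrN.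
elim: N => [|N IHN].
  rewrite (_ : [set _ | _] = setT); first exact: openT.
  by apply/seteqP; split.
rewrite (_ : [set _ | _] = [set y | forall j, (j < N)%N -> `|coord y j| < r j]
    `&` [set y | `|coord y N| < r N]); first by apply: openI.
apply/seteqP; split=> [y /= hy|y /= [hy hN] j].
  by split=> [j jN|]; apply: hy => //; rewrite ltnW.
by rewrite ltnS leq_eqVlt => /predU1P[->|/hy].
Qed.

End Coordinates.

(** * Adding one block to a given vector *)

Section Blocks.
Variables (F : numFieldType) (X : completeNormedModType F).
Implicit Types (x y s u : X) (d : F).

Lemma super_ADP_approx x (W : set X) d : super_ADP X -> unit_sphere x ->
  relatively_weakly_open (@unit_ball F X) W -> W `&` @unit_sphere F X !=set0 -> 0 < d ->
  exists y theta, [/\ W y, `|theta| = 1 & 2 - d < `|x + theta *: y|].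
Proof.
move=> adp x1 Wop W0 d0; have [_ lub] := adp x W x1 Wop W0.
apply: contrapT => none.
have /lub : ubound [set M | exists2 y, W y &
    is_max [set `|x + theta *: y| | theta in @unimodular F] M] (2 - d).
  move=> _ [y Wy [[theta th1 <-] _]].
  (* The order of [F] is only partial, so negating the strict inequality requires both sides to be
     real. *)
  rewrite real_leNgt ?normr_real //; last first.
    by rewrite rpredB // ?gtr0_real // ltr0n.
  by apply/negP => lt2; apply: none; exists y, theta.
by rewrite lerDl oppr_ge0 => /(lt_le_trans d0); rewrite ltxx.
Qed.

Variables (e : nat -> X) (K : F).
Hypothesis K1 : 1 <= K.
Hypothesis uncond_e : unconditional_basis K e.
Hypothesis adp : super_ADP X.

Let basis_e := uncond_e.1.

Lemma unit_block_step x (N : nat) d : unit_sphere x -> 0 < d -> d < 1 ->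
  exists M (a : nat -> F), let u := \sum_(N <= j < M) a j *: e j in
    `|u| = 1 /\ 2 - d < `|x + u|.
Proof.
(* Of the six parts of [d], one is lost in the super ADP, two in truncating [y] and three in
   normalizing. *)
move=> x1 d0 d1; pose t := d / 6%:R.
have t0 : 0 < t by rewrite divr_gt0 ?ltr0n.
have dE : d = t *+ 6 by rewrite -mulr_natr mulfVK // pnatr_eq0.
have e0 j : 0 < `|e j| by rewrite normr_gt0 (basis_neq0 basis_e).
(* With these radii the [N] terms below [N] add up to at most [t]; [N.+1] avoids dividing by
   zero. *)
pose r j := t / N.+1%:R / `|e j|.
have r0 j : 0 < r j by rewrite !divr_gt0 // ltr0n.
pose U := [set y | forall j, (j < N)%N -> `|coord basis_e y j| < r j].
have [] := @super_ADP_approx x (@unit_ball F X `&` U) t adp x1.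
- by exists U => //; exact: (weak_open_coord basis_e K1 uncond_e).
- have eN0 := e0 N.
  (* The normalized [e N] lies in the open set, since its coordinates below [N] vanish. *)
  exists (`|e N|^-1 *: e N); have eN1 : `|(`|e N|^-1 *: e N)| = 1.
    by rewrite normrZ normfV normr_id mulVf ?gt_eqF.
  split => //; split; first by rewrite /unit_ball /= eN1.
  move=> j ltjN; rewrite -/(coord_fun basis_e j _) linearZ /= /coord_fun.
  by rewrite coord_basis (ltn_eqF ltjN) scaler0 normr0.
- exact: t0.
move=> y [theta [[y1 Uy] th1 xy]].
have [M leNM yM] := @partial_sum_close _ _ _ basis_e y t N t0.
pose v := \sum_(N <= j < M) coord basis_e y j *: e j.
have yv : `|y - v| <= t *+ 2.
  pose w := \sum_(0 <= j < N) coord basis_e y j *: e j.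
  (* The tail from [M] on and the head below [N] contribute at most [t] each. *)
  have -> : y - v = (y - (w + v)) + w by rewrite opprD [- w - v]addrC addrA subrK.
  rewrite -(big_cat_nat (leq0n N) leNM) (le_trans (ler_normD _ _)) //.
  rewrite mulr2n lerD // ?(ltW yM) // (le_trans (ler_norm_sum _ _ _)) //.
  rewrite big_mkord (@le_trans _ _ (\sum_(j < N) t / N.+1%:R)) //.
    by apply: ler_sum => j _; rewrite normrZ -ler_pdivlMr // ltW // Uy.
  rewrite sumr_const card_ord -[_ *+ N]mulr_natr -mulrA ger_pMr //.
  by rewrite mulrC ler_pdivrMr ?ltr0n // mul1r ler_nat.
have thv : `|theta *: (y - v)| <= t *+ 2 by rewrite normrZ th1 mul1r.
have xv : 2 - t *+ 3 < `|x + theta *: v|.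
  rewrite mulrS opprD addrA ltrBlDr (lt_le_trans xy) //.
  rewrite (le_trans _ (lerD (lexx _) thv)) // (le_trans _ (ler_normD _ _)) //.
  by rewrite -addrA -scalerDr subrKC.
have v_le : `|v| <= 1 + t *+ 3.
  rewrite -(subrK y v) addrC (le_trans (ler_normD _ _)) // lerD // distrC.
  by rewrite (le_trans yv) // ler_wpMn2l // ltW.
(* Since [x] is a unit vector, a sum of norm close to 2 forces [v] to have norm close to at least
   1. *)
have v_ge : 1 - t *+ 3 <= `|v|.
  have := le_trans (ltW xv) (ler_normD _ _); rewrite x1 normrZ th1 mul1r.
  by rewrite -lerBlDl addrAC [2 - 1](_ : _ = 1) // -[2]/(1 + 1) addrK.
have v0 : 0 < `|v|.
  rewrite (lt_le_trans _ v_ge) // subr_gt0 (le_lt_trans _ d1) // dE.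
  by rewrite ler_wpMn2l // ltW.
exists M, (fun j => (theta / `|v|) * coord basis_e y j) => /=.
under eq_bigr do rewrite -scalerA.
rewrite -scaler_sumr -/v; split.
  by rewrite normrZ normrM normfV normr_id th1 mul1r mulVf ?gt_eqF.
rewrite dE (_ : 6 = 3 + 3)%N // mulrnDr opprD addrA ltrBlDr.
rewrite (lt_le_trans xv) //.
(* Normalizing [v] moves it by a vector of norm [| |v| - 1 |], which is at most [3t]. *)
have -> : x + theta *: v = x + (theta / `|v|) *: v + (theta * (1 - `|v|^-1)) *: v.
  by rewrite -addrA -scalerDl mulrBr mulr1 subrKC.
rewrite (le_trans (ler_normD _ _)) // lerD //.
rewrite normrZ normrM th1 mul1r -{2}(normr_id v) -normrM mulrBl mul1r.
rewrite mulVf ?gt_eqF // real_ler_distl ?v_ge ?v_le //.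
by rewrite rpredB ?rpred1 ?normr_real.
Qed.

Lemma block_step s (N : nat) d : 0 < d ->
  exists M (a : nat -> F), let u := \sum_(N <= j < M) a j *: e j in
    `|u| = 1 /\ `|s| + 1 - d < `|s + u|.
Proof.
move=> d0.
(* For [s = 0] any unit vector can serve as the direction [x]. *)
have [x x1 sx] : exists2 x : X, `|x| = 1 & s = `|s| *: x.
  have unit_normalize (z : X) : z != 0 -> `|(`|z|^-1 *: z)| = 1.
    by move=> z0; rewrite normrZ normfV normr_id mulVf ?normr_eq0.
  have [->|s0] := eqVneq s 0.
    exists (`|e 0|^-1 *: e 0%N); last by rewrite normr0 scale0r.
    exact/unit_normalize/(basis_neq0 basis_e).
  exists (`|s|^-1 *: s); first exact: unit_normalize.
  by rewrite scalerA divff ?normr_eq0 // scale1r.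
have t0 : 0 < 1 + `|s| by rewrite ltr_pwDl.
have d1 : 0 < 1 + d by rewrite addr_gt0.
(* The error will be multiplied by [1 + |s|]; the factor [1 / (1 + d)] makes the tolerance smaller
   than 1. *)
have [||M [a [u1 xu]]] := @unit_block_step x N (d / (1 + d) / (1 + `|s|)) x1.
- by rewrite !divr_gt0.
- rewrite ltr_pdivrMr // mul1r (@lt_le_trans _ _ 1) ?lerDl //.
  by rewrite ltr_pdivrMr // mul1r ltrDr.
exists M, a; split=> //; move: u1 xu; set u := \sum_(_ <= _ < _) _ => u1 xu.
(* With [t = |s|], [t x + u = (1 + t) (x + u) - (x + t u)] covers both [t >= 1]
   and [t <= 1]. *)
have -> : s + u = (1 + `|s|) *: (x + u) - (x + `|s| *: u).
  by rewrite {1}sx scalerDl scale1r scalerDr [x + u]addrC addrACA addrK addrC.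
rewrite (lt_le_trans _ (lerB_normD _ _)) // ltrBrDr.
rewrite (@le_lt_trans _ _ (`|s| + 1 - d + (1 + `|s|))) //.
  rewrite lerD2l normrN (le_trans (ler_normD _ _)) // x1 normrZ normr_id u1.
  by rewrite mulr1.
rewrite -(ltr_pM2l t0) in xu; rewrite normrZ gtr0_norm // (le_lt_trans _ xu) //.
rewrite mulrBr [X in _ <= _ - X]mulrC mulfVK ?gt_eqF // mulr_natr mulr2n.
rewrite (addrC (`|s|) 1) addrAC lerD2l lerN2 ler_pdivrMr //.
by rewrite ler_peMr ?lerDl // ltW.
Qed.

End Blocks.

(** * Infinite sequences of blocks and their unconditionality *)

Section BlockSequences.
Variables (F : numFieldType) (X : completeNormedModType F) (e : nat -> X).
Variables (K : F) (K1 : 1 <= K) (uncond_e : unconditional_basis K e).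

(** Each new block raises the norm of the running sum by more than [1 - d]. The bound starts at one
    block because it is strict and the empty sum is 0. *)
Lemma exists_block_sequence d : super_ADP X -> 0 < d ->
  exists (c : nat -> nat) (a : nat -> nat -> F),
    let u k := \sum_(c k <= j < c k.+1) a k j *: e j in
    [/\ c 0%N = 0%N, forall k, `|u k| = 1
      & forall m, (1 - d) * m.+1%:R < `|\sum_(k < m.+1) u k|].
Proof.
move=> adp d0.
have /choice[f fP] (p : nat * X) : exists q : nat * (nat -> F),
    let u := \sum_(p.1 <= j < q.1) q.2 j *: e j in
    `|u| = 1 /\ `|p.2| + 1 - d < `|p.2 + u|.
  by have [M [a ?]] := block_step K1 uncond_e adp p.2 p.1 d0; exists (M, a).
(* A state holds the index where the next block starts and the sum of the blocks chosen so far. *)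
pose step p := let q := f p in (q.1, p.2 + \sum_(p.1 <= j < q.1) q.2 j *: e j).
pose state k := iter k step (0%N, 0).
exists (fst \o state), (fun k => (f (state k)).2).
have u1 k := (fP (state k)).1.
have sumE m : \sum_(k < m) \sum_((state k).1 <= j < (state k.+1).1)
    (f (state k)).2 j *: e j = (state m).2.
  by elim: m => [|m IHm]; [rewrite big_ord0 | rewrite big_ord_recr /= IHm].
split => // m; rewrite sumE; elim: m => [|m IHm].
  have /= := (fP (state 0%N)).2; rewrite normr0 add0r mulr1.
  exact.
rewrite -natr1 mulrDr mulr1 (le_lt_trans _ (fP (state m.+1)).2) //.
by rewrite -addrA lerD2r ltW.
Qed.

(** The intervals are disjoint, so a basis index determines its block; this lets block coefficients
    be read as basis coefficients. *)
Lemma block_index (c : nat -> nat) : (forall k, (c k <= c k.+1)%N) ->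
  exists idx : nat -> nat, forall k j, (c k <= j < c k.+1)%N -> idx j = k.
Proof.
move=> c_le; have c_homo := homo_leq leqnn leq_trans c_le.
have /choice[idx idxP] (j : nat) :
    exists l, forall k, (c k <= j < c k.+1)%N -> l = k.
  have [[l /andP[lj jl]]|none] := pselect (exists l, (c l <= j < c l.+1)%N).
    exists l => k /andP[kj jk]; apply/eqP; rewrite eqn_leq.
    apply/andP; split; rewrite leqNgt; apply/negP => /c_homo.
      by rewrite leqNgt (leq_ltn_trans lj jk).
    by rewrite leqNgt (leq_ltn_trans kj jl).
  (* Indices outside all intervals get the default value 0. *)
  by exists 0%N => k jk; case: none; exists k.
by exists idx => k j /idxP.
Qed.

(** Expanded in the basis, both sums carry the same factors [a], so the inequality between [b] and
    [b'] passes to the basis coefficients. *)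
Lemma block_sum_unconditional (c : nat -> nat) (a : nat -> nat -> F) m
    (u : nat -> X) (b b' : nat -> F) :
  (forall k, u k = \sum_(c k <= j < c k.+1) a k j *: e j) ->
  c 0%N = 0%N -> (forall k, (c k <= c k.+1)%N) ->
  (forall k, `|b k| <= `|b' k|) ->
  `|\sum_(k < m) b k *: u k| <= K * `|\sum_(k < m) b' k *: u k|.
Proof.
move=> uE c0 c_le bb'; have [idx idxP] := block_index c_le.
have sumE (g : nat -> F) : \sum_(k < m) g k *: u k =
    \sum_(j < c m) (g (idx j) * a (idx j) j) *: e j.
  rewrite -(big_mkord xpredT (fun j => (g (idx j) * a (idx j) j) *: e j)).
  elim: m => [|n IHn]; first by rewrite c0 big_ord0 big_geq.
  rewrite big_ord_recr IHn (big_cat_nat (leq0n (c n)) (c_le n)) /=; congr (_ + _).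
  rewrite uE scaler_sumr; apply: eq_big_nat => j /idxP->.
  by rewrite scalerA.
rewrite !sumE; apply: (uncond_e.2 _ (fun j => b (idx j) * a (idx j) j)
  (fun j => b' (idx j) * a (idx j) j)) => j _.
by rewrite !normrM ler_wpM2r.
Qed.

Lemma successive_blocks_sums (c : nat -> nat) (a : nat -> nat -> F) m :
  (forall k, (c k < c k.+1)%N) ->
  successive_blocks e
    (fun k : 'I_m => \sum_(c k <= j < c k.+1) a k j *: e j).
Proof.
move=> c_lt; exists (fun k : 'I_m => seq_fset tt (index_iota (c k) (c k.+1))).
split=> [k|k|k l lk i j].
- by apply/fset0Pn; exists (c k); rewrite seq_fsetE mem_index_iota leqnn c_lt.
- exists (a k); apply/esym/perm_big.
  by rewrite (perm_trans (seq_fset_perm _ _)) // undup_id // iota_uniq.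
- rewrite !seq_fsetE !mem_index_iota lk => /andP[_ ik] /andP[kj _].
  exact: leq_trans kj.
Qed.

End BlockSequences.

(** * Estimates against the norm of l1 *)

(* Compare [b j] with its upper bound [B], the total sum:
   [|sum b_j u_j| >= B |sum u_j| - sum (B - b_j)]. *)
Lemma l1_lower_bound (F : numFieldType) (X : normedModType F) m
    (u : 'I_m -> X) (b : 'I_m -> F) (d : F) :
  (forall k, `|u k| = 1) -> (1 - d) * m%:R <= `|\sum_(k < m) u k| ->
  (forall k, 0 <= b k) ->
  (1 - m%:R * d) * \sum_(k < m) b k <= `|\sum_(k < m) b k *: u k|.
Proof.
move=> u1 sum_ge b0; set B := \sum_(k < m) b k.
have B0 : 0 <= B by apply: sumr_ge0.
have bB k : b k <= B by rewrite /B (bigD1 k) //= lerDl sumr_ge0.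
have -> : \sum_k b k *: u k = B *: (\sum_k u k) - \sum_k (B - b k) *: u k.
  rewrite scaler_sumr -sumrB; apply: eq_bigr => k _.
  by rewrite scalerBl subKr.
rewrite (le_trans _ (lerB_normD _ _)) // normrN lerBrDr.
rewrite (@le_trans _ _ ((1 - m%:R * d) * B + \sum_k (B - b k))) //.
  rewrite lerD2l (le_trans (ler_norm_sum _ _ _)) // ler_sum // => k _.
  by rewrite normrZ u1 mulr1 ger0_norm // subr_ge0.
rewrite sumrB sumr_const card_ord -/B normrZ (ger0_norm B0).
rewrite (le_trans _ (ler_wpM2l B0 sum_ge)) // le_eqVlt; apply/orP; left; apply/eqP.
rewrite -[B *+ m]mulr_natr; ring.
Qed.

Lemma exists_l1_blocks (F : numFieldType) (X : completeNormedModType F)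
    (K : F) (e : nat -> X) m (eps : F) :
  1 <= K -> unconditional_basis K e -> super_ADP X -> (0 < m)%N -> 0 < eps ->
  exists u : 'I_m -> X,
    [/\ successive_blocks e u,
        normalized u,
        `|\sum_(j < m) u j| > (1 - eps) * m%:R
      & forall a : 'I_m -> F,
          (1 - m%:R * eps) / K * \sum_(j < m) `|a j|
            <= `|\sum_(j < m) a j *: u j|
          /\ `|\sum_(j < m) a j *: u j| <= \sum_(j < m) `|a j|].
Proof.
move=> K1 uncond_e adp m0 eps0.
have [c [al [c0 u1 sum_gt]]] := exists_block_sequence K1 uncond_e adp eps0.
(* An empty interval would give the block 0, which is not a unit vector. *)
have c_lt k : (c k < c k.+1)%N.
  rewrite ltnNge; apply/negP => ck; have := u1 k.
  by rewrite big_geq // normr0 => /esym/eqP; rewrite oner_eq0.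
pose u k := \sum_(c k <= j < c k.+1) al k j *: e j.
have sum_m : (1 - eps) * m%:R < `|\sum_(j < m) u j| by case: m m0.
exists (fun k : 'I_m => u k); split=> //.
- exact: successive_blocks_sums.
- by move=> k; exact: u1.
move=> a; split; last first.
  rewrite (le_trans (ler_norm_sum _ _ _)) // ler_sum // => j _.
  by rewrite normrZ u1 mulr1.
have K0 : 0 < K by rewrite (lt_le_trans ltr01).
(* Extension of [a] by 0 to all naturals, as [block_sum_unconditional] expects. *)
pose a' k := if insub k is Some i then a i else 0.
have a'E (j : 'I_m) : a' j = a j by rewrite /a' valK.
rewrite mulrAC ler_pdivrMr // [_ * K]mulrC.
have -> : \sum_(j < m) a j *: u j = \sum_(j < m) a' j *: u j.
  by apply: eq_bigr => j _; rewrite a'E.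
(* [|a' k|] and [a' k] have equal moduli, so passing to nonnegative coefficients costs only the
   factor [K]. *)
rewrite (le_trans _ (block_sum_unconditional uncond_e m (fun=> erefl) c0
  (fun k => ltnW (c_lt k)) (b := fun k => `|a' k|) (b' := a') _)) //.
  rewrite (le_trans (l1_lower_bound
    (u := u) (b := fun j : 'I_m => `|a j|) _ (ltW sum_m) _)) //.
    by move=> k; exact: u1.
  by under eq_bigr do rewrite -a'E.
by move=> k; rewrite normr_id.
Qed.

Lemma exists_equivalent_l1_blocks (F : numFieldType)
    (X : completeNormedModType F) (K : F) (e : nat -> X) m (eta : F) :
  1 <= K -> unconditional_basis K e -> super_ADP X -> (0 < m)%N -> 0 < eta ->
  exists u : 'I_m -> X,
    [/\ successive_blocks e u,
        normalized u
      & equivalent_l1 (K * (1 + eta)) u].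
Proof.
move=> K1 uncond_e adp m0 eta0.
have m_gt0 : 0 < m%:R :> F by rewrite ltr0n.
have eta1 : 0 < 1 + eta by rewrite addr_gt0.
(* Chosen so that [1 - m * eps = 1 / (1 + eta)]. *)
have eps0 : 0 < eta / (1 + eta) / m%:R by rewrite !divr_gt0.
have [u [blocks norm_u _ l1_u]] := exists_l1_blocks K1 uncond_e adp m0 eps0.
exists u; split=> // a; have [lower upper] := l1_u a.
have K0 : 0 < K by rewrite (lt_le_trans ltr01).
split.
  rewrite (_ : (K * (1 + eta))^-1 = (1 - m%:R * (eta / (1 + eta) / m%:R)) / K) //.
  by field; rewrite !gt_eqF.
rewrite (le_trans upper) // ler_peMl ?sumr_ge0 //.
by rewrite mulr_ege1 // lerDl ltW.
Qed.

Unset Implicit Arguments.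

Theorem proposition3p2 (R : realType) (k : scalars)
    (X : completeNormedModType (scalar_field R k))
    (K : scalar_field R k) (e : nat -> X)
    (K1 : 1 <= K) (He : unconditional_basis K e) (HX : super_ADP X) :
  (forall (m : nat) (eps : scalar_field R k),
      (0 < m)%N -> 0 < eps -> eps < m%:R^-1 ->
      exists u : 'I_m -> X,
        [/\ successive_blocks e u,
            normalized u,
            `|\sum_(j < m) u j| > (1 - eps) * m%:R
          & forall a : 'I_m -> scalar_field R k,
              (1 - m%:R * eps) / K * \sum_(j < m) `|a j|
                <= `|\sum_(j < m) a j *: u j|
              /\ `|\sum_(j < m) a j *: u j| <= \sum_(j < m) `|a j|])
  /\
  (forall (m : nat) (eta : scalar_field R k),
      (0 < m)%N -> 0 < eta ->
      exists u : 'I_m -> X,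
        [/\ successive_blocks e u,
            normalized u
          & equivalent_l1 (K * (1 + eta)) u]).
Proof.
split=> [m eps m0 eps0 _|m eta m0 eta0]; first exact: exists_l1_blocks.
exact: exists_equivalent_l1_blocks.
Qed.
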